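(* For the cycle $C_n$ with $n\ge 3$, $$PRC(C_n)=\begin{cases} n & \text{if } n\in\{3,4,6\},\\ 3 & \text{if } n=5,\\ 4 & \text{if } n=8,\\ 5 & \text{if } n\in\{7,11\},\\ 6 & \text{otherwise.}\end{cases}$$
   Context: All graphs are simple, finite and undirected. A set $S\subseteq V(G)$ is a dominating set if every vertex not in $S$ has a neighbor in $S$; $S$ is a perfect dominating set if every vertex in $V(G)\setminus S$ has exactly one neighbor in $S$. A perfect coalition in $G$ consists of two disjoint sets $V_1,V_2$ of vertices such that (i) neither $V_1$ nor $V_2$ is a dominating set of $G$; (ii) each vertex in $V(G)\setminus V_1$ has at most one neighbor in $V_1$, and each vertex in $V(G)\setminus V_2$ has at most one neighbor in $V_2$; (iii) $V_1\cup V_2$ is a perfect dominating set of $G$. A perfect coalition partition ($prc$-partition) of $G$ is a vertex partition $\pi=\{V_1,\dots,V_k\}$ such that each $V_i$ either is a singleton dominating set or forms a perfect coalition with some $V_j\in\pi$. $PRC(G)$ is the maximum cardinality of a $prc$-partition of $G$, with $PRC(G)=0$ if $G$ has no $prc$-partition. $C_n$ denotes the cycle on $n$ vertices. *)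

(* Defs.v *)
From mathcomp Require Import all_boot.

Set Implicit Arguments.
Unset Strict Implicit.
Unset Printing Implicit Defensive.

(* A finite simple graph is a finType [T] of vertices with a symmetric and
   irreflexive adjacency relation [e]; the predicates below are meant for
   such [e]. *)
Section PerfectCoalitions.

Variables (T : finType) (e : rel T).
Implicit Types (S A B : {set T}) (P : {set {set T}}).

Definition nbrs_in (v : T) S : {set T} := [set u in S | e v u].

Definition dominating S : bool :=
  [forall v, (v \notin S) ==> [exists u in S, e v u]].

Definition perfect_dominating S : bool :=
  [forall v, (v \notin S) ==> (#|nbrs_in v S| == 1)].

Definition at_most_one_nbr S : bool :=
  [forall v, (v \notin S) ==> (#|nbrs_in v S| <= 1)].

Definition perfect_coalition A B : bool :=
  [&& [disjoint A & B],
      ~~ dominating A && ~~ dominating B,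
      at_most_one_nbr A && at_most_one_nbr B
    & perfect_dominating (A :|: B)].

Definition singleton_dominating S : bool := (#|S| == 1) && dominating S.

(* [partition] requires the blocks to be nonempty. *)
Definition prc_partition P : bool :=
  partition P [set: T] &&
  [forall A in P,
     singleton_dominating A || [exists B in P, perfect_coalition A B]].

(* The maximum over an empty range is 0, which is the value assigned to a
   graph without prc-partition. *)
Definition PRC : nat := \max_(P : {set {set T}} | prc_partition P) #|P|.

End PerfectCoalitions.

(* [ordS i] is the cyclic successor of [i] in 'I_n.  This relation is a simple
   graph when n >= 2, and it is the cycle C_n when n >= 3. *)
Definition cycle_adj (n : nat) : rel 'I_n :=
  fun i j => (j == ordS i) || (i == ordS j).

Lemma cycle_adj_sym n : symmetric (@cycle_adj n).
Proof. by move=> i j; rewrite /cycle_adj orbC. Qed.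

Lemma cycle_adj_irrefl n : 1 < n -> irreflexive (@cycle_adj n).
Proof.
move=> n_gt1 i; rewrite /cycle_adj orbb; apply/negbTE/eqP => /(congr1 val) /=.
have [lt_in | ge_in] := ltnP i.+1 n; first by rewrite modn_small // => /n_Sn.
have -> : i.+1 = n by apply/eqP; rewrite eqn_leq ge_in ltn_ord.
by rewrite modnn => i0; rewrite i0 leqNgt n_gt1 in ge_in.
Qed.

(* Main.v *)
Require Import Defs.
From mathcomp Require Import all_boot zify.

Set Implicit Arguments.
Unset Strict Implicit.
Unset Printing Implicit Defensive.

(* Upper bounds.  For n >= 4 every block has a coalition partner, and every
   coalition, being dominating, meets the closed neighbourhood of each vertex.
   Applied to a vertex that a block A does not dominate, this yields a vertex
   cover of the coalition graph with at most three blocks, A not among them;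
   a graph without isolated vertices in which every vertex is avoided by such a
   cover has at most six vertices.  If there are at least five blocks, there
   are two disjoint coalitions A, B and C, D.  The complement of a perfect
   dominating set consists of runs of length two, so a coalition has at least
   n - 2 * floor(n / 3) vertices, and counting vertices gives
   n >= 2 * (n - 2 * floor(n / 3)) + (k - 4) for k blocks; this settles
   n = 7, 8, 11 and most of n = 5.

   Lower bounds.  A vertex colouring read along the cycle is a cyclic word, and
   being a prc-partition depends only on the factors of length three of this
   word.  Such words can be lengthened by a period of length three, so three
   base words, of lengths 6, 10 and 14, give six blocks for all remaining n. *)

(** * Graphs in which each vertex is avoided by a small vertex cover *)

Section CoverGraphs.

Variables (T : finType) (V : {set T}) (r : rel T).
Hypothesis r_sym : symmetric r.
Hypothesis r_irr : {in V, forall A, ~~ r A A}.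
Hypothesis no_isolated : {in V, forall A, exists2 B, B \in V & r A B}.

(** Usually called a vertex cover: it consists of vertices, and the edges are what it covers. *)
Definition edge_cover (C : {set T}) : Prop :=
  {in V &, forall A B, r A B -> (A \in C) || (B \in C)}.

(** Fix an edge [A B]. Without two disjoint edges, every other vertex is adjacent to [A] or [B]. If
    some [C] is adjacent to [B], an edge from [A] to a further vertex would be disjoint from [B C],
    so [B] is the centre; otherwise [A] is. *)
Lemma disjoint_edges_or_star :
  3 < #|V| ->
  (exists A B C D, [/\ uniq [:: A; B; C; D],
      {subset [:: A; B; C; D] <= V}, r A B & r C D])
  \/ (exists2 A, A \in V & {in V, forall B, B != A -> r A B}).
Proof.
move=> V4; have [A AV] : exists A, A \in V by apply/card_gt0P; lia.
have [B BV rAB] := no_isolated AV.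
have nAB : A != B by apply: contraTneq rAB => <-; exact: r_irr.
have [/existsP[C /existsP[D]]|none] := boolP [exists C, exists D,
    [&& uniq [:: A; B; C; D], C \in V, D \in V & r C D] ||
    [&& uniq [:: A; C; B; D], C \in V, D \in V, r A C & r B D]].
  case/orP=> [/and4P[uq CV DV rCD]|/and5P[uq CV DV rAC rBD]]; left.
  - exists A, B, C, D; split=> //.
    by move=> x; rewrite !inE => /or4P[] /eqP->.
  - exists A, C, B, D; split=> //.
    by move=> x; rewrite !inE => /or4P[] /eqP->.
have no1 C D : C \in V -> D \in V -> r C D -> uniq [:: A; B; C; D] -> False.
  move=> CV DV rCD uq; move/negP: none; apply; apply/existsP; exists C.
  by apply/existsP; exists D; rewrite uq CV DV rCD.
have no2 C D : C \in V -> D \in V -> r A C -> r B D -> uniq [:: A; C; B; D] ->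
    False.
  move=> CV DV rAC rBD uq; move/negP: none; apply; apply/existsP; exists C.
  by apply/existsP; exists D; rewrite uq CV DV rAC rBD orbT.
have adj C : C \in V -> C != A -> C != B -> r A C || r B C.
  move=> CV CA CB; have [D DV rCD] := no_isolated CV.
  have nCD : C != D by apply: contraTneq rCD => <-; exact: r_irr.
  have [eDA|nDA] := eqVneq D A; first by rewrite r_sym -eDA rCD.
  have [eDB|nDB] := eqVneq D B; first by rewrite (r_sym B) -eDB rCD orbT.
  case: (no1 C D CV DV rCD); rewrite /= !inE !negb_or nAB nCD.
  by rewrite ![A == _]eq_sym ![B == _]eq_sym CA CB nDA nDB.
right; have [/existsP[C /and4P[CV CA CB rBC]]|noC] :=
    boolP [exists C, [&& C \in V, C != A, C != B & r B C]]; last first.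
  exists A => // C CV CA; have [->//|CB] := eqVneq C B.
  case/orP: (adj C CV CA CB) => // rBC.
  by case/existsP: noC; exists C; rewrite CV CA CB.
have allB D : D \in V -> D != A -> D != B -> D != C -> r B D.
  move=> DV DA DB DC; case/orP: (adj D DV DA DB) => // rAD.
  case: (no2 D C DV CV rAD rBC); rewrite /= !inE !negb_or nAB DB DC.
  by rewrite ![A == _]eq_sym ![B == _]eq_sym CA CB DA.
exists B => // D DV DB; have [->|DA] := eqVneq D A; first by rewrite r_sym.
by have [->//|DC] := eqVneq D C; exact: allB.
Qed.

Hypothesis covers :
  {in V, forall A, exists C, [/\ edge_cover C, A \notin C & #|C| <= 3]}.

(** A cover avoiding the centre of a star contains all its leaves, and here there are at least
    four. *)
Lemma disjoint_edges :
  4 < #|V| ->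
  exists A B C D, [/\ uniq [:: A; B; C; D],
      {subset [:: A; B; C; D] <= V}, r A B & r C D].
Proof.
move=> V5; have [//|[A AV rA]] := disjoint_edges_or_star (ltnW V5).
have [C [covC AC C3]] := covers AV.
have sub : V :\ A \subset C.
  apply/subsetP=> B; rewrite !inE => /andP[BA BV].
  by have := covC _ _ AV BV (rA B BV BA); rewrite (negbTE AC).
by have := subset_leq_card sub; have := cardsD1 A V; rewrite AV; lia.
Qed.

(** With seven vertices, at least four lie outside a cover [K], each attached to a chosen centre in
    [K]. The covers avoiding the centres force two centres with two leaves each, and leave no
    possible neighbour for the third vertex of [K]. *)
Lemma card_le6 : #|V| <= 6.
Proof.
rewrite leqNgt; apply/negP => V7.
have [A0 A0V] : exists A, A \in V by apply/card_gt0P; lia.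
have [K [covK _ K3]] := covers A0V.
(* The default [x] never occurs on [V :\: K], where a neighbour exists and must lie in [K]. *)
pose f x := odflt x [pick y in V | r x y].
have fP x : x \in V :\: K -> [/\ f x \in V, r x (f x) & f x \in K].
  rewrite inE /f => /andP[xK xV]; case: pickP => [y /andP[yV rxy]|none] /=.
    by have := covK _ _ xV yV rxy; rewrite (negbTE xK).
  by have [y yV rxy] := no_isolated xV; have := none y; rewrite yV rxy.
pose L U := [set x in V :\: K | f x == U].
pose I := f @: (V :\: K).
pose g x := if x \in K then x else f x.
have IV U : U \in I -> U \in V by case/imsetP=> x /fP[? _ _] ->.
have IK U : U \in I -> U \in K by case/imsetP=> x /fP[_ _ ?] ->.
have hit C U x : edge_cover C -> x \in L U -> (U \in C) || (x \in C).
  rewrite inE => covC /andP[xVK /eqP eU]; have [fV rf _] := fP x xVK.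
  have xV : x \in V by case/setDP: xVK.
  by have := covC _ _ xV fV rf; rewrite eU orbC.
have gL U x : x \in L U -> g x = U.
  by rewrite !inE /g => /andP[/andP[/negbTE-> _] /eqP].
have gI U : U \in I -> g U = U by move/IK; rewrite /g => ->.
have LI U : U \in I -> exists x, x \in L U.
  by case/imsetP=> x xVK ->; exists x; rewrite inE xVK eqxx.
(* A cover avoiding [U] contains [L U] and, for every other centre, that centre or all its leaves;
   [g] sends both to the centre, so the part outside [L U] has at least [#|I :\ U|] elements. *)
have avoid U : U \in I -> exists C, [/\ edge_cover C, U \notin C,
    #|L U| + #|C :\: L U| <= 3, #|I :\ U| <= #|C :\: L U| & L U \subset C].
  move=> UI; have [C [covC UC C3]] := covers (IV _ UI).
  have LC : L U \subset C.
    by apply/subsetP=> x /(hit C) -/(_ covC); rewrite (negbTE UC).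
  exists C; split=> //.
    by have := cardsID (L U) C; rewrite (setIidPr LC); lia.
  apply: leq_trans (leq_imset_card g _); apply: subset_leq_card.
  apply/subsetP=> W /setD1P[WU WI]; have [x xL] := LI W WI.
  have out y : g y = W -> y \notin L U.
    by move=> gy; apply: contraNN WU => /gL <-; rewrite gy.
  case/orP: (hit _ _ _ covC xL) => inC.
    by apply/imsetP; exists W; rewrite ?gI // inE inC out // gI.
  by apply/imsetP; exists x; rewrite ?(gL _ _ xL) // inE inC out // (gL _ _ xL).
have IsubK : I \subset K by apply/subsetP=> U /IK.
have cI := subset_leq_card IsubK.
have cVK : #|V :\: K| = \sum_(U in I) #|L U|.
  rewrite -sum1_card (partition_big_imset f) /=; apply: eq_bigr => U _.
  by rewrite -sum1_card; apply: eq_bigl => x; rewrite !inE.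
have cV := cardsID K V; have cVI := subset_leq_card (subsetIr V K).
have cL U : U \in I -> #|L U| + #|I| <= 4.
  move=> UI; have [C [_ _ ? ? _]] := avoid U UI.
  by have := cardsD1 U I; rewrite UI; lia.
have bound : #|V :\: K| <= #|I| * (4 - #|I|).
  rewrite cVK -sum_nat_const; apply: leq_sum => U /cL; lia.
(* For [m <= 3], [m * (4 - m)] is at most 4, with equality only at [m = 2], while at least four
   vertices lie outside [K]. *)
have [cI2 cK3 cVK4] : [/\ #|I| = 2, #|V :&: K| = 3 & #|V :\: K| = 4].
  by move: bound; case: #|I| (leq_trans cI K3) => [|[|[|[|]]]] //; split; lia.
have [U [U' [nUU' defI]]] : exists x y, x != y /\ I = [set x; y].
  by apply/cards2P; rewrite cI2.
have [UI U'I] : U \in I /\ U' \in I by rewrite defI !inE !eqxx orbT.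
have [cLU cLU'] : #|L U| = 2 /\ #|L U'| = 2.
  have := cL _ UI; have := cL _ U'I; rewrite cI2; move: cVK.
  by rewrite defI big_setU1 ?inE //= big_set1; lia.
have [W /setIP[WV WK] WI] : exists2 W, W \in V :&: K & W \notin I.
  apply/subsetPn/negP => /subset_leq_card; lia.
have [X XV rWX] := no_isolated WV.
(* The cover avoiding [U1] is [L U1] and [U2], so it contains [X] but not [W]. *)
have main U1 U2 : U1 \in I -> U2 \in I -> U2 != U1 -> #|L U1| = 2 ->
    #|L U2| = 2 -> (X \in L U1) || (X == U2).
  move=> U1I U2I n21 c1 c2; have [C [covC U1C cC _ LC]] := avoid U1 U1I.
  have dis y : y \in L U2 -> y \notin L U1.
    by move=> /gL gy; apply: contraNN n21 => /gL <-; rewrite gy.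
  have U2L : U2 \notin L U1 by rewrite !inE IK.
  have U2C : U2 \in C.
    apply: contraTT cC => U2C; have : L U2 \subset C :\: L U1.
      apply/subsetP=> y yL; rewrite inE dis //=.
      by have := hit C _ _ covC yL; rewrite (negbTE U2C).
    by move/subset_leq_card; rewrite c1 c2 -ltnNge (leq_add2l 2 2).
  have C1 : C :\: L U1 = [set U2].
    apply/esym/eqP; rewrite eqEcard cards1 sub1set inE U2L U2C /=.
    by move: cC; rewrite c1 -(leq_add2l 2).
  have inC y : y \in C -> (y \in L U1) || (y == U2).
    by move=> yC; case: (boolP (y \in L U1)) => // yL;
      rewrite -in_set1 -C1 inE yL.
  have WC : W \notin C.
    apply/negP => /inC; rewrite !inE WK /= => /eqP eW.
    by rewrite eW U2I in WI.
  by have := covC _ _ WV XV rWX; rewrite (negbTE WC) => /inC.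
have nU'U : U' != U by rewrite eq_sym.
(* The two instances clash: [L U] and [L U'] are disjoint and miss [K], which contains the distinct
   [U] and [U']. *)
have := main U U' UI U'I nU'U cLU cLU'; have := main U' U U'I UI nUU' cLU' cLU.
case/orP=> [/[dup] /gL gX XL|/eqP->].
  case/orP=> [/gL gX'|/eqP eX]; first by rewrite -gX gX' eqxx in nUU'.
  by move: XL; rewrite eX !inE IK.
by rewrite !inE IK //= (negbTE nUU').
Qed.
End CoverGraphs.

(** * Domination on the cycle through predecessors and successors *)

Section Cycle.

Variables (n : nat).
Implicit Types (i v : 'I_n) (S A B : {set 'I_n}).

Local Notation adj := (@cycle_adj n).

Definition cnbhd v : {set 'I_n} := [set ord_pred v; v; ordS v].

Lemma cycle_adjE v u : adj v u = (u == ord_pred v) || (u == ordS v).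
Proof.
by rewrite /cycle_adj orbC [v == ordS u]eq_sym (can2_eq (@ordSK n) (@ord_predK n)).
Qed.

Lemma dominatingP S :
  reflect (forall v, ~~ [disjoint cnbhd v & S]) (dominating adj S).
Proof.
apply: (iffP forallP) => dom v.
  have [vS|vS] := boolP (v \in S).
    by apply/pred0Pn; exists v; rewrite /= vS !inE eqxx orbT.
  have /existsP[u /andP[uS]] := implyP (dom v) vS; rewrite cycle_adjE => vu.
  by apply/pred0Pn; exists u; rewrite /= uS !inE orbAC vu.
apply/implyP => vS; have /pred0Pn[u /=] := dom v; rewrite !inE orbAC.
case/andP=> /orP[vu|/eqP->] uS; last by rewrite uS in vS.
by apply/existsP; exists u; rewrite uS cycle_adjE.
Qed.

Hypothesis n_ge3 : 2 < n.

Lemma ordS_neq_pred v : ordS v != ord_pred v.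
Proof.
apply/negP => /eqP/(congr1 val) /=; have v_lt := ltn_ord v.
have [v0|v_gt0] := posnP v.
  by rewrite v0 add0n !modn_small; lia.
have -> : (v + n).-1 = v.-1 + n by lia.
rewrite modnDr (modn_small (m := v.-1)); last by lia.
case: (ltngtP v.+1 n) => [lt|gt|eq]; [|lia|].
  by rewrite modn_small; lia.
by rewrite eq modnn; lia.
Qed.

Lemma card_cnbhd v : #|cnbhd v| = 3.
Proof.
have := cycle_adj_irrefl (ltnW n_ge3) v; rewrite cycle_adjE.
rewrite /cnbhd -!setUA !cardsU1 cards1 !inE negb_or.
rewrite ![ord_pred v == _]eq_sym ordS_neq_pred.
by case: (v == _); case: (v == _).
Qed.

Lemma card_nbrs_in v S :
  #|nbrs_in adj v S| = (ord_pred v \in S) + (ordS v \in S).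
Proof.
rewrite -sum1_card big_mkcond (bigD1 (ord_pred v)) //=.
rewrite (bigD1 (ordS v)) ?ordS_neq_pred //=.
rewrite big1 ?addn0 => [|u /andP[/negbTE up /negbTE uS]].
  by rewrite !inE !cycle_adjE !eqxx orbT !andbT; do 2!case: ifP.
by rewrite !inE cycle_adjE up uS andbF.
Qed.

Lemma perfect_dominatingP S :
  reflect (forall v, v \notin S -> (ord_pred v \in S) (+) (ordS v \in S))
    (perfect_dominating adj S).
Proof.
by apply: (iffP forallP) => h v; have := h v; rewrite card_nbrs_in;
  case: (v \in S); case: (_ \in S); case: (_ \in S) => //= /(_ isT).
Qed.

Lemma at_most_one_nbrP S :
  reflect (forall v, v \notin S -> ~~ ((ord_pred v \in S) && (ordS v \in S)))
    (at_most_one_nbr adj S).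
Proof.
by apply: (iffP forallP) => h v; have := h v; rewrite card_nbrs_in;
  case: (v \in S); case: (_ \in S); case: (_ \in S) => //= /(_ isT).
Qed.

Lemma perfect_dominating_dominating S :
  perfect_dominating adj S -> dominating adj S.
Proof.
move=> /perfect_dominatingP perf; apply/dominatingP => v.
have [vS|/perf] := boolP (v \in S).
  by apply/pred0Pn; exists v; rewrite /= vS !inE eqxx orbT.
case: (boolP (ord_pred v \in S)) => [pS _|_ /= sS]; apply/pred0Pn.
  by exists (ord_pred v); rewrite /= pS !inE eqxx.
by exists (ordS v); rewrite /= sS !inE eqxx !orbT.
Qed.

(* The complement consists of runs of length exactly two: [ordS] maps the
   first vertices of the runs onto the last ones, and these into [S]. *)
Lemma perfect_dominating_card S :
  perfect_dominating adj S -> n <= #|S| + (n %/ 3).*2.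
Proof.
move=> /perfect_dominatingP perf.
pose F := [set v in ~: S | ordS v \notin S].
have FT : ~: S :&: F = F by apply/setIidPr/subsetP=> v; rewrite inE; case/andP.
have FL : @ordS n @: F = ~: S :\: F.
  apply/setP=> u; rewrite -[u](@ord_predK n) mem_imset; last exact: ordS_inj.
  set v := ord_pred u; rewrite !inE.
  have := perf (ordS v); rewrite ordSK.
  case: (v \in S); case: (ordS v \in S); case: (ordS _ \in S) => //= /(_ isT).
    by [].
  by [].
have LS : @ordS n @: (~: S :\: F) \subset S.
  apply/subsetP=> _ /imsetP[v vL ->]; move: vL; rewrite !inE.
  by case: (v \in S); case: (ordS v \in S).
(* There are [#|F|] runs, so [n = #|S| + 2 * #|F|] with [#|F| <= #|S|]; hence [3 * #|F| <= n]. *)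
have := subset_leq_card LS; have := cardsID F (~: S); have := cardsC S.
rewrite FT -FL !card_imset; try exact: ordS_inj.
rewrite card_ord; move: #|S| #|F| #|~: S| => a b c; lia.
Qed.

End Cycle.

Lemma ordS2_notin_cnbhd m (x : 'I_m) : m = 5 -> ordS (ordS x) \notin cnbhd x.
Proof.
by move=> m5; subst m; case: x => -[|[|[|[|[|]]]]] // ?; rewrite !inE -!val_eqE.
Qed.

(** * Upper bounds for prc-partitions of the cycle *)

Section CyclePartition.

Variables (n : nat) (P : {set {set 'I_n}}).
Implicit Types (v : 'I_n) (A B C D X : {set 'I_n}).

Local Notation adj := (@cycle_adj n).
Local Notation coal := (perfect_coalition adj).

Hypothesis n_ge4 : 3 < n.
Hypothesis prcP : prc_partition adj P.

Let n_ge3 : 2 < n := ltnW n_ge4.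

Let partP : partition P [set: 'I_n].
Proof. by case/andP: prcP. Qed.

Lemma coalition_sym : symmetric coal.
Proof.
move=> A B; rewrite /perfect_coalition disjoint_sym setUC.
by rewrite [~~ _ && _]andbC [at_most_one_nbr _ A && _]andbC.
Qed.

Lemma block_neq0 A : A \in P -> A != set0.
Proof. by case/and3P: partP => _ _ P0; apply: contraTneq => ->. Qed.

Lemma coalition_irr : {in P, forall A, ~~ coal A A}.
Proof.
move=> A /block_neq0; apply: contra => /and4P[dAA _ _ _].
by rewrite -setI_eq0 setIid in dAA.
Qed.

Lemma cnbhd_sym (u v : 'I_n) : (u \in cnbhd v) = (v \in cnbhd u).
Proof.
rewrite !inE (eq_sym u (ord_pred v)) (can2_eq (@ord_predK n) (@ordSK n)).
rewrite (eq_sym u (ordS v)) (can2_eq (@ordSK n) (@ord_predK n)) (eq_sym u v).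
rewrite (eq_sym v (ord_pred u)) (eq_sym v (ordS u)) (eq_sym v u).
by do 3!case: (_ == _).
Qed.

(** A dominating singleton would have the whole cycle as its closed neighbourhood, which has only
    three vertices. *)
Lemma block_coalition : {in P, forall A, exists2 B, B \in P & coal A B}.
Proof.
move=> A AP; case/andP: prcP => _ /forall_inP/(_ A AP)/orP[|/exists_inP//].
case/andP=> /cards1P[x ->] /dominatingP dom.
have sub : [set: 'I_n] \subset cnbhd x.
  apply/subsetP=> v _; have /pred0Pn[u /andP[/= uv]] := dom v.
  by rewrite inE => /eqP eu; rewrite cnbhd_sym -eu.
have := subset_leq_card sub.
by rewrite card_cnbhd // cardsT card_ord leqNgt n_ge4.
Qed.

Lemma coalition_meets A B v :
  coal A B -> ~~ [disjoint cnbhd v & A] || ~~ [disjoint cnbhd v & B].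
Proof.
case/and4P=> _ _ _ /(perfect_dominating_dominating n_ge3)/dominatingP/(_ v).
by rewrite -!setI_eq0 setIUr setU_eq0 negb_and.
Qed.

Lemma pblock_eq A v : A \in P -> v \in A -> pblock P v = A.
Proof. by case/and3P: partP => _ tI _; exact: def_pblock. Qed.

Lemma mem_block v : v \in pblock P v.
Proof. by rewrite mem_pblock; case/and3P: partP => /eqP->; rewrite inE. Qed.

(* Every coalition meets each closed neighbourhood; take one missed by [A]. *)
Lemma coalition_covers : {in P, forall A, exists C : {set {set 'I_n}},
  [/\ edge_cover P coal C, A \notin C & #|C| <= 3]}.
Proof.
move=> A AP; have [B BP /and4P[_ /andP[ndA _] _ _]] := block_coalition AP.
have [v dis] : exists v, [disjoint cnbhd v & A].
  apply/existsP; apply: contraNT ndA; rewrite negb_exists => /forallP dom.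
  exact/dominatingP.
exists (pblock P @: cnbhd v); split.
- have inC X : X \in P -> ~~ [disjoint cnbhd v & X] -> X \in pblock P @: cnbhd v.
    move=> XP /pred0Pn[u /andP[/= uv uX]].
    by apply/imsetP; exists u => //; rewrite (pblock_eq XP uX).
  by move=> X Y XP YP /(coalition_meets v)/orP[] /inC-> //; rewrite orbT.
- apply/imsetP=> -[u uv eA]; have uA : u \in A by rewrite eA mem_block.
  by move/pred0P: dis => /(_ u); rewrite /= uv uA.
- by rewrite -(card_cnbhd n_ge3 v) leq_imset_card.
Qed.

(** Each block outside [s] contributes at least one vertex. *)
Lemma card_blocks (s : seq {set 'I_n}) : uniq s -> {subset s <= P} ->
  \sum_(X <- s) #|X| + (#|P| - size s) <= n.
Proof.
move=> uq sP; pose Q := [set X in s].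
have QP : Q \subset P by apply/subsetP=> X; rewrite inE => /sP.
have cQ : #|Q| = size s by rewrite cardsE; exact/card_uniqP.
have -> : \sum_(X <- s) #|X| = \sum_(X in Q) #|X|.
  by rewrite big_uniq //; apply: eq_bigl => X; rewrite inE.
rewrite -[X in _ <= X](card_ord n) -cardsT (card_partition partP).
rewrite [X in _ <= X](big_setID Q) /= (setIidPr QP) leq_add2l -cQ.
have := cardsID Q P; rewrite (setIidPr QP) => <-; rewrite addKn.
rewrite -sum1_card; apply: leq_sum => X /setDP[XP _].
by rewrite card_gt0 block_neq0.
Qed.

Lemma coalition_card A B : coal A B -> n <= #|A| + #|B| + (n %/ 3).*2.
Proof.
case/and4P=> dAB _ _ /(perfect_dominating_card n_ge3).
by rewrite cardsU; move: dAB; rewrite -setI_eq0 => /eqP->; rewrite cards0 subn0.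
Qed.

Lemma prc_card_le6 : #|P| <= 6.
Proof.
exact: card_le6 block_coalition coalition_covers.
Qed.

Lemma disjoint_coalitions_card A B C D :
  uniq [:: A; B; C; D] -> {subset [:: A; B; C; D] <= P} ->
  coal A B -> coal C D -> n + #|P| <= 4 + (n %/ 3) * 4.
Proof.
move=> uq sub /coalition_card cAB /coalition_card cCD.
have := card_blocks uq sub; have := subset_leq_card (introT subsetP sub).
rewrite (card_uniqP uq) /= !big_cons big_nil.
move: #|A| #|B| #|C| #|D| #|P| cAB cCD => a b c d p; lia.
Qed.

Lemma prc_card_ge5 : 4 < #|P| -> n + #|P| <= 4 + (n %/ 3) * 4.
Proof.
move=> P5; have [A [B [C [D [uq sub cAB cCD]]]]] :=
  disjoint_edges coalition_sym coalition_irr block_coalition coalition_covers P5.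
exact: disjoint_coalitions_card uq sub cAB cCD.
Qed.

(* In a star of coalitions on [C_5], the centre [A] has two vertices and the
   leaves one, so [A] is the complement of the neighbourhood of a vertex [x]
   that it does not dominate; but then [x |: A] is not perfect dominating. *)
Lemma prc_card_cycle5 : n = 5 -> #|P| <= 3.
Proof.
move=> n5; rewrite leqNgt; apply/negP => P4.
case: (disjoint_edges_or_star coalition_sym coalition_irr block_coalition P4).
  case=> [A [B [C [D [uq sub cAB cCD]]]]].
  (* For [n = 5] the bound reads [5 + #|P| <= 8]. *)
  have := disjoint_coalitions_card uq sub cAB cCD.
  by move: #|P| P4 => p; lia.
case=> A AP star.
(* Perfect domination gives [5 <= #|A| + #|B| + 2]; the other blocks, at least two, give the reverse
   bound. *)
have leaf B : B \in P -> B != A -> #|A| + #|B| = 3.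
  move=> BP BA; have := coalition_card (star B BP BA).
  have uq : uniq [:: A; B] by rewrite /= inE eq_sym BA.
  have sub : {subset [:: A; B] <= P} by move=> X; rewrite !inE => /orP[]/eqP->.
  have := card_blocks uq sub; rewrite /= !big_cons big_nil.
  by move: #|A| #|B| #|P| P4 => a b p; lia.
(* Counting vertices, [5 = a + (#|P| - 1) * (3 - a)] with [a = #|A|] and [#|P| >= 4]; only [a = 2]
   is possible. *)
have cA : #|A| = 2.
  have := card_partition partP; rewrite cardsT card_ord (big_setD1 A) //=.
  rewrite (eq_bigr (fun=> 3 - #|A|)) => [|B /setD1P[BA BP]]; last first.
    by rewrite -(leaf B BP BA) addKn.
  rewrite sum_nat_const; have := cardsD1 A P; rewrite AP.
  have : exists2 B, B \in P & B != A.
    have [B BP cAB] := block_coalition AP; exists B => //.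
    by apply: contraTneq cAB => ->; exact: coalition_irr.
  case=> B BP BA; have := leaf B BP BA; have := block_neq0 BP; rewrite -card_gt0.
  move: #|A| #|B| #|P| #|P :\ A| P4 => a b p q; nia.
have [B BP cAB] := block_coalition AP.
have [/and4P[_ /andP[ndA _] _ _]] := cAB.
have [x dis] : exists x, [disjoint cnbhd x & A].
  apply/existsP; apply: contraNT ndA; rewrite negb_exists => /forallP dom.
  exact/dominatingP.
have defA : A = ~: cnbhd x.
  apply/eqP; rewrite eqEcard cA -disjoints_subset disjoint_sym dis /=.
  have := cardsC (cnbhd x); rewrite card_ord card_cnbhd //.
  by move: #|~: _| => c; lia.
have xA : x \notin A by rewrite defA !inE eqxx orbT.
pose X := pblock P x.
have XP : X \in P by apply: pblock_mem; case/and3P: partP => /eqP->; rewrite inE.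
have XA : X != A by apply: contraNneq xA => <-; exact: mem_block.
have eX : X = [set x].
  apply/esym/eqP; rewrite eqEcard cards1 sub1set mem_block.
  by have := leaf X XP XA; rewrite cA => /(@addnI 2 _ 1) ->.
case/and4P: (star X XP XA) => _ _ _ /(perfect_dominatingP n_ge3)/(_ (ordS x)).
have SSx : ordS (ordS x) \in A by rewrite defA inE ordS2_notin_cnbhd.
have Sx : ordS x \notin A :|: X.
  rewrite eX defA !inE eqxx !orbT /=.
  have /negbT := cycle_adj_irrefl (ltnW n_ge3) x.
  by rewrite cycle_adjE negb_or [x == ordS x]eq_sym => /andP[].
by move/(_ Sx); rewrite ordSK !in_setU mem_block SSx orbT.
Qed.

End CyclePartition.

(** * Cyclic words as vertex colourings *)

Fixpoint triples (s : seq nat) : seq (nat * nat * nat) :=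
  if s is a :: s1 then
    if s1 is b :: c :: _ then (a, b, c) :: triples s1 else [::]
  else [::].

Lemma mem_triples s i : i.+2 < size s ->
  (nth 0 s i, nth 0 s i.+1, nth 0 s i.+2) \in triples s.
Proof.
elim: s i => [|a [|b [|c s]] IHs] [|i] //= lt_is; rewrite inE ?eqxx //.
by rewrite (IHs i) ?orbT.
Qed.

Lemma triplesP s t : t \in triples s ->
  exists2 i, i.+2 < size s & t = (nth 0 s i, nth 0 s i.+1, nth 0 s i.+2).
Proof.
elim: s => [|a [|b [|c s]] IHs] //; rewrite [triples _]/= inE.
case/orP=> [/eqP->|/IHs[i lt_is ->]]; first by exists 0.
by exists i.+1.
Qed.

(** Repeating the first two letters turns the cyclic factors of length three into ordinary ones. *)
Definition wrap (s : seq nat) := s ++ take 2 s.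

Section Words.

(* The colours are [0, .., k.-1]; [nth 0 p x] is the coalition partner of [x]. *)
Variables (k : nat) (p : seq nat).

Definition partner_ok : bool :=
  all (fun x => (nth 0 p x < k) && (nth 0 p x != x)) (iota 0 k).

(** The conditions at a vertex coloured [b] whose neighbours are coloured [a] and [c]: at most one
    neighbour in each other class, and perfect domination by each class joined with its partner
    class. *)
Definition triple_ok (t : nat * nat * nat) : bool :=
  let: (a, b, c) := t in
  (b < k) && all (fun x =>
    ((b == x) || ~~ ((a == x) && (c == x))) &&
    let S := pred2 x (nth 0 p x) in S b || (S a (+) S c)) (iota 0 k).

Definition occurs x (t : nat * nat * nat) : bool := t.1.2 == x.
(** The middle vertex witnesses that the class of [x] is not dominating. *)
Definition misses x (t : nat * nat * nat) : bool :=
  [&& t.1.1 != x, t.1.2 != x & t.2 != x].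

Definition coalition_word (s : seq nat) : bool :=
  all triple_ok (triples (wrap s)) &&
  all (fun x => has (occurs x) (triples (wrap s)) &&
                has (misses x) (triples (wrap s))) (iota 0 k).

(** Prepending a period to a word that starts with [a, b] keeps all its cyclic factors and adds just
    the three listed. *)
Lemma coalition_word_insert a b c s :
  all triple_ok [:: (a, b, c); (b, c, a); (c, a, b)] ->
  coalition_word [:: a, b & s] -> coalition_word [:: a, b, c, a, b & s].
Proof.
have e : triples (wrap [:: a, b, c, a, b & s]) =
  [:: (a, b, c); (b, c, a); (c, a, b)] ++ triples (wrap [:: a, b & s])
  by rewrite /wrap /= take0.
rewrite /coalition_word {}e all_cat => -> /andP[-> /allP hs] /=.
by apply/allP=> x /hs /andP[oc ms]; rewrite oc ms !orbT.
Qed.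

(** The colour classes form the partition: cyclic factors are exactly the colour patterns around the
    vertices, and [p] supplies the coalition partners. *)
Lemma coalition_word_PRC n s : 2 < n -> size s = n ->
  partner_ok -> coalition_word s -> k <= PRC (@cycle_adj n).
Proof.
move=> n_ge3 szs /allP pok /andP[/allP ok /allP occ].
pose w (i : 'I_n) := nth 0 s i.
have wrapE i : i < n.+2 -> nth 0 (wrap s) i = nth 0 s (i %% n).
  move=> lt_in; rewrite nth_cat szs; case: ltnP => [lt|ge].
    by rewrite modn_small.
  rewrite nth_take; last by lia.
  by rewrite -[in RHS](subnK ge) modnDr modn_small //; lia.
have szw : size (wrap s) = n.+2.
  by rewrite size_cat size_take szs n_ge3 addn2.
have w0 i : i < n -> nth 0 (wrap s) i = nth 0 s i.
  by move=> lt_in; rewrite wrapE ?modn_small //; lia.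
have wS i : i < n -> nth 0 (wrap s) i.+1 = nth 0 s (i.+1 %% n).
  by move=> lt_in; rewrite wrapE //; lia.
have wSS i : i < n -> nth 0 (wrap s) i.+2 = nth 0 s ((i.+1 %% n).+1 %% n).
  move=> lt_in; rewrite -[(_ %% n).+1]addn1 modnDml addn1.
  case: (ltnP i.+2 n.+2) => lt; last by lia.
  by rewrite wrapE.
pose tri v := (w (ord_pred v), w v, w (ordS v)).
have tri_in v : tri v \in triples (wrap s).
  (* The factor starting at position [i] is centred at the successor of [i]. *)
  have [i ->] : exists i, v = ordS i by exists (ord_pred v); rewrite ord_predK.
  have := @mem_triples (wrap s) i; rewrite szw !ltnS ltn_ord => /(_ isT).
  by rewrite wSS // wS // w0 // /tri ordSK.
have in_tri t : t \in triples (wrap s) -> exists v, t = tri v.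
  case/triplesP=> i; rewrite szw !ltnS => lt_in ->; exists (ordS (Ordinal lt_in)).
  by rewrite wSS // wS // w0 // /tri ordSK.
have w_lt v : w v < k by have /andP[] := ok _ (tri_in v).
have okx v x : x < k ->
    (w v == x) || ~~ ((w (ord_pred v) == x) && (w (ordS v) == x)) /\
    let S := pred2 x (nth 0 p x) in
    S (w v) || (S (w (ord_pred v)) (+) S (w (ordS v))).
  move=> lt_xk; have /andP[_ /allP/(_ x)] := ok _ (tri_in v).
  by rewrite mem_iota => /(_ lt_xk)/andP.
have occx x : x < k -> exists v, w v = x.
  move=> lt_xk; have := occ x; rewrite mem_iota => /(_ lt_xk)/andP[/hasP[t]].
  by case/in_tri=> v -> /eqP; exists v.
have missx x : x < k -> exists v, misses x (tri v).
  move=> lt_xk; have := occ x; rewrite mem_iota => /(_ lt_xk)/andP[_ /hasP[t]].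
  by case/in_tri=> v -> ?; exists v.
pose B x := [set v | w v == x].
pose P := [set B (val x) | x : 'I_k].
have B_inj : injective (fun x : 'I_k => B (val x)).
  move=> x y /setP eB; have [v wv] := occx x (ltn_ord x).
  by apply/val_inj; have := eB v; rewrite !inE /= wv eqxx => /esym/eqP.
have <- : #|P| = k by rewrite card_imset // card_ord.
apply: leq_bigmax_cond; apply/andP; split.
  apply/and3P; split.
  - rewrite eqEsubset subsetT /=; apply/subsetP=> v _; apply/bigcupP.
    by exists (B (w v)); [apply/imsetP; exists (Ordinal (w_lt v))|rewrite inE].
  - apply/trivIsetP=> _ _ /imsetP[x _ ->] /imsetP[y _ ->] nB.
    rewrite -setI_eq0; apply/eqP/setP=> v; rewrite !inE.
    by apply: contraNF nB => /andP[/eqP<- /eqP->].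
  - apply/imsetP=> -[x _ /setP]; have [v wv] := occx x (ltn_ord x).
    by move/(_ v); rewrite !inE wv eqxx.
have ndom x : x < k -> ~~ dominating (@cycle_adj n) (B x).
  move=> /missx[v /and3P[m1 m2 m3]]; apply/negP => /dominatingP/(_ v)/pred0Pn[u].
  by rewrite /= !inE => /andP[/orP[/orP[]|] /eqP->]; apply/negP.
have amo x : x < k -> at_most_one_nbr (@cycle_adj n) (B x).
  move=> lt_xk; apply/at_most_one_nbrP => // v; rewrite !inE.
  by have [/orP[->|]] := okx v x lt_xk.
apply/forall_inP=> _ /imsetP[[x lt_xk] _ ->] /=; apply/orP; right.
have /andP[lt_yk nyx] : (nth 0 p x < k) && (nth 0 p x != x).
  by apply: pok; rewrite mem_iota.
apply/exists_inP; exists (B (nth 0 p x)).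
  by apply/imsetP; exists (Ordinal lt_yk).
rewrite /perfect_coalition !ndom // !amo //= andbC; apply/andP; split.
  apply/perfect_dominatingP => // v; rewrite !inE.
  by have [_ /= +] := okx v x lt_xk; move=> + /negbTE e; rewrite e.
rewrite -setI_eq0; apply/eqP/setP=> v; rewrite !inE.
by apply: contraNF nyx => /andP[wx /eqP <-].
Qed.

End Words.

(** * Explicit words for the lower bounds, and the final values *)

Lemma prc_cycle_ge6 n : 5 < n -> n \notin [:: 7; 8; 11] ->
  6 <= PRC (@cycle_adj n).
Proof.
move=> n6 nn.
pose ins t i s := iter i (cat t) s : seq nat.
have size_ins a b c i s : size (ins [:: a; b; c] i s) = 3 * i + size s.
  by elim: i => //= i ->; lia.
have word p a b c i s :
    all (triple_ok 6 p) [:: (a, b, c); (b, c, a); (c, a, b)] ->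
    coalition_word 6 p [:: a, b & s] ->
    coalition_word 6 p (ins [:: a; b; c] i [:: a, b & s]).
  move=> ok oks; suff [t -> okt] : exists2 t,
      ins [:: a; b; c] i [:: a, b & s] = [:: a, b & t] &
      coalition_word 6 p [:: a, b & t].
    by [].
  elim: i => [|i [t et okt]]; first by exists s.
  exists [:: c, a, b & t]; first by rewrite /= et.
  exact: coalition_word_insert.
(* The base lengths 6, 10 and 14 cover the residues 0, 1 and 2 modulo 3; from 6 on they leave out
   only 7, 8 and 11. *)
have [i [r0|r1|r2]] : exists i, [\/ n = 3 * i + 6, n = 3 * i + 10 | n = 3 * i + 14].
  exists (if n %% 3 == 0 then (n - 6) %/ 3
          else if n %% 3 == 1 then (n - 10) %/ 3 else (n - 14) %/ 3).
  move: nn; rewrite !inE; case: ifP => [r0|r0]; last case: ifP => [r1|r1].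
  - by constructor 1; lia.
  - by constructor 2; lia.
  - by constructor 3; lia.
(* Here the partners form the perfect matching 0-3, 1-4, 2-5. *)
- apply: (@coalition_word_PRC 6 [:: 3; 4; 5; 0; 1; 2] n
    (ins [:: 0; 1; 2] i [:: 0; 1; 2; 3; 4; 5])) => //; first by lia.
    by rewrite size_ins.
  exact: word.
(* Here they form two stars, with centre 0 and leaves 4, 5, and with centre 1 and leaves 2, 3. *)
- apply: (@coalition_word_PRC 6 [:: 4; 2; 1; 1; 0; 0] n
    (ins [:: 4; 1; 5] i [:: 4; 1; 5; 0; 1; 2; 0; 3; 1; 0])) => //; first by lia.
    by rewrite size_ins.
  exact: word.
- apply: (@coalition_word_PRC 6 [:: 4; 2; 1; 1; 0; 0] n
    (ins [:: 0; 3; 2] i [:: 0; 3; 1; 0; 0; 1; 1; 0; 4; 1; 5; 0; 1; 2])) => //.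
  + by lia.
  + by rewrite size_ins.
  exact: word.
Qed.

(** In a triangle every singleton is dominating, so the partition into singletons works. *)
Lemma prc_cycle3_ge3 : 3 <= PRC (@cycle_adj 3).
Proof.
pose P := [set [set i] | i : 'I_3].
suff prcP : prc_partition (@cycle_adj 3) P.
  by rewrite (leq_trans _ (leq_bigmax_cond _ prcP)) // card_imset ?card_ord //;
    exact: set1_inj.
apply/andP; split.
  apply/and3P; split.
  - rewrite eqEsubset subsetT; apply/subsetP=> v _; apply/bigcupP.
    by exists [set v]; rewrite ?inE ?imset_f.
  - apply/trivIsetP=> _ _ /imsetP[x _ ->] /imsetP[y _ ->] nxy.
    by rewrite disjoints1 inE; apply: contraNN nxy => /eqP->.
  - by apply/imsetP=> -[x _ /setP/(_ x)]; rewrite !inE eqxx.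
apply/forall_inP=> _ /imsetP[x _ ->]; rewrite /singleton_dominating cards1 /=.
apply/orP; left; apply/dominatingP => v.
have /eqP-> : cnbhd v == [set: 'I_3].
  by rewrite eqEcard subsetT cardsT card_ord card_cnbhd.
by apply/pred0Pn; exists x; rewrite /= !inE eqxx.
Qed.

Theorem theorem3p7 (n : nat) (hn : 3 <= n) :
  PRC (@cycle_adj n) =
    if n \in [:: 3; 4; 6] then n
    else if n == 5 then 3
    else if n == 8 then 4
    else if n \in [:: 7; 11] then 5
    else 6.
Proof.
apply/eqP; rewrite eqn_leq; apply/andP; split.
  apply/bigmax_leqP => P prcP.
  have leP_n : #|P| <= n.
    by have := card_blocks prcP (s := [::]) isT; rewrite big_nil subn0; apply.
  have [n3|n_ge4] : n = 3 \/ 3 < n by lia.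
    by move: #|P| leP_n => m; rewrite n3.
  move: leP_n (prc_card_le6 n_ge4 prcP) (prc_card_ge5 n_ge4 prcP)
    (prc_card_cycle5 n_ge4 prcP).
  move: #|P| => m le_n le6 ge5 c5; rewrite !inE.
  (* For [n = 7, 8, 11], five or more blocks would give [m <= 5], [m <= 4] and [m <= 5]
     respectively. *)
  by do !case: ifP => ?; lia.
have [n_in|] := boolP (n \in [:: 3; 4; 5; 7; 8; 11]).
  move: n_in; rewrite !inE.
  case/or4P => [/eqP->|/eqP->|/eqP->|/or3P[]/eqP->] /=.
  - exact: prc_cycle3_ge3.
  - exact: (@coalition_word_PRC 4 [:: 1; 0; 3; 2] 4 [:: 0; 1; 2; 3]).
  - exact: (@coalition_word_PRC 3 [:: 2; 2; 0] 5 [:: 0; 0; 1; 1; 2]).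
  - exact: (@coalition_word_PRC 5 [:: 3; 2; 1; 0; 1] 7
      [:: 0; 0; 1; 2; 3; 4; 1]).
  - exact: (@coalition_word_PRC 4 [:: 2; 3; 0; 0] 8
      [:: 0; 0; 1; 1; 0; 2; 1; 3]).
  - exact: (@coalition_word_PRC 5 [:: 3; 2; 1; 0; 1] 11
      [:: 0; 0; 1; 1; 0; 0; 1; 2; 3; 4; 1]).
rewrite !inE !negb_or => nn; apply: leq_trans (prc_cycle_ge6 _ _).
- by do !case: ifP => ?; lia.
- lia.
- by rewrite !inE; lia.
Qed.
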